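(* Let $(X,d)$ and $(\Lambda,\rho)$ be compact metric spaces, let $\omega:\Lambda\times X\to X$ be continuous, and fix a Borel probability measure $p$ on $\Lambda$. Suppose $\omega$ is $\mathbb{P}$-weakly hyperbolic, i.e. $\mathbb{P}(S)=1$ where $$S=\{\sigma\in\Omega:\ \lim_{n\to\infty}\operatorname{Diam}(\omega_{\sigma_1}\circ\cdots\circ\omega_{\sigma_n}(X))=0\}.$$ Then the operator $T_p:\mathcal{M}_1(X)\to\mathcal{M}_1(X)$ has a unique fixed point $\mu_p$, and $T_p^n(\nu)\to\mu_p$ in the weak$^*$ topology for every $\nu\in\mathcal{M}_1(X)$. Furthermore, if $p(U)>0$ for every nonempty open set $U\subset\Lambda$, then $\operatorname{supp}(\mu_p)=\overline{\Gamma(S)}$.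
   Context: For $\lambda\in\Lambda$, $\omega_\lambda:X\to X$ is $\omega_\lambda(x)=\omega(\lambda,x)$. $\Omega=\Lambda^{\mathbb{N}}$ with the product topology, and $\mathbb{P}=p^{\mathbb{N}}$ is the product (Bernoulli) measure on $\Omega$ induced by $p$. $\operatorname{Diam}(A)=\sup\{d(x,y):x,y\in A\}$. $\mathcal{M}_1(X)$ is the set of Borel probability measures on $X$ with the weak$^*$ topology. The transfer operator is $T_p(\mu)(B)=\int_\Lambda \mu(\omega_\lambda^{-1}(B))\,dp(\lambda)$ for Borel $B\subset X$. For $\sigma\in S$ the nested compact sets $\omega_{\sigma_1}\circ\cdots\circ\omega_{\sigma_n}(X)$ have intersection consisting of a single point, denoted $\Gamma(\sigma)$; this defines $\Gamma:S\to X$ (equivalently $\Gamma(\sigma)=\lim_n \omega_{\sigma_1}\circ\cdots\circ\omega_{\sigma_n}(x)$ for any $x\in X$). *)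

(* Defs.v *)
From HB Require Import structures.
From mathcomp Require Import all_boot all_order all_algebra.
From mathcomp Require Import all_classical all_reals all_analysis.
Set Implicit Arguments. Unset Strict Implicit. Unset Printing Implicit Defensive.
Import Order.TTheory GRing.Theory Num.Theory.
Import numFieldNormedType.Exports.
Local Open Scope classical_set_scope.
Local Open Scope ring_scope.

(* Compact metric spaces in the paper are nonempty (otherwise M_1(X) is
   empty); measurableType requires a pointed carrier, so we work with metric
   spaces equipped with a point. *)
#[short(type="pointedMetricType")]
HB.structure Definition PointedMetric (K : numDomainType) :=
  { M of Metric K M & isPointed M }.

Definition borel_of (T : ptopologicalType) := g_sigma_algebraType (@open T).

Definition cylinders (L : ptopologicalType) : set (set (nat -> borel_of L)) :=
  [set A | exists n, exists2 B : set (borel_of L), measurable B &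
           A = (fun s : nat -> borel_of L => s n) @^-1` B].

Definition Omega (L : ptopologicalType) :=
  g_sigma_algebraType (@cylinders L).

Definition is_product_measure (R : realType) (L : ptopologicalType)
  (p : probability (borel_of L) R) (P : probability (Omega L) R) : Prop :=
  forall (n : nat) (B : nat -> set (borel_of L)),
    (forall i, measurable (B i)) ->
    P [set s : Omega L | forall i, (i < n)%N -> B i (s i)]
      = (\prod_(i < n) p (B i))%E.

(* omega_{s_0} o ... o omega_{s_(n-1)} (the paper indexes from 1) *)
Fixpoint comp_n (L X : Type) (w : L * X -> X) (s : nat -> L) (n : nat) : X -> X :=
  match n with
  | 0 => id
  | m.+1 => comp_n w s m \o (fun x => w (s m, x))
  end.

Definition Diam (R : realType) (X : metricType R) (A : set X) : R :=
  sup [set r | exists x, exists y, [/\ A x, A y & r = mdist x y]].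

Definition S_hyp (R : realType) (L : topologicalType) (X : metricType R)
  (w : L * X -> X) : set (nat -> L) :=
  [set s | (fun n => Diam (comp_n w s n @` [set: X])) @ \oo --> (0 : R)].

(* Gamma(S): for s in S the nested compact sets comp_n w s n (X) have a single
   common point Gamma(s); Gamma(S) is the set of these points. *)
Definition Gamma_img (R : realType) (L : topologicalType) (X : metricType R)
  (w : L * X -> X) : set X :=
  [set x | exists2 s, S_hyp w s & forall n, (comp_n w s n @` [set: X]) x].

Definition transfer (R : realType) (L X : ptopologicalType)
  (w : L * X -> X) (p : probability (borel_of L) R)
  (mu : set (borel_of X) -> \bar R) : set (borel_of X) -> \bar R :=
  fun B => (\int[p]_(l in [set: borel_of L]) mu ((fun x : X => w (l, x)) @^-1` B))%E.

Definition supp (R : realType) (X : ptopologicalType)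
  (mu : set (borel_of X) -> \bar R) : set X :=
  [set x | forall U : set X, open U -> U x -> (0 < mu U)%E].

Definition weak_star_cvg (R : realType) (X : ptopologicalType)
  (nu : nat -> probability (borel_of X) R) (mu : probability (borel_of X) R) : Prop :=
  forall f : X -> R, continuous f ->
    (fun n => \int[nu n]_(x in [set: borel_of X]) (f x)%:E)%E @ \oo -->
      (\int[mu]_(x in [set: borel_of X]) (f x)%:E)%E.

(* Main.v *)
Require Import Defs.
From HB Require Import structures.
From mathcomp Require Import all_boot all_order all_algebra.
From mathcomp Require Import all_classical all_reals all_analysis.
From mathcomp Require Import measurable_realfun lra.
Set Implicit Arguments. Unset Strict Implicit. Unset Printing Implicit Defensive.
Import Order.TTheory GRing.Theory Num.Theory.
Import numFieldNormedType.Exports.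
Local Open Scope classical_set_scope.
Local Open Scope ring_scope.

(* Prepending a p-distributed letter to a P-distributed sequence gives a
   P-distributed sequence, so T_p^n(nu) is the law of omega_{s_1} o ... o
   omega_{s_n}(x) for (s, x) distributed as P x nu.  For s in S these points
   converge to Gamma(s) whatever x is, and dominated convergence gives
   T_p^n(nu) -> mu_p := Gamma_* P.  The cocycle identity
   Gamma(l :: s) = omega_l(Gamma(s)) makes mu_p a fixed point, and any fixed
   point nu = T_p^n(nu) -> mu_p equals mu_p.  For the support: if s is in S and
   U is a neighbourhood of Gamma(s), then some finite composition along s maps
   X well inside U; by uniform continuity the same holds along all sequences of
   a cylinder around s, which has positive measure. *)

(** * Borel sets, measurability criteria and continuity of the distance *)

Lemma open_measurable_borel {T : ptopologicalType} {U : set T} :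
  open U -> measurable (U : set (borel_of T)).
Proof. exact: sub_sigma_algebra. Qed.

Lemma countable_bigcup_measurable d (T : measurableType d) (I : choiceType)
  (D : set I) (F : I -> set T) :
  countable D -> (forall i, D i -> measurable (F i)) ->
  measurable (\bigcup_(i in D) F i).
Proof.
move=> /countable_injP[f finj] mF; rewrite bigcup_set_type.
apply: countable_bigcupT_measurable => [|i]; last exact/mF/set_valP.
apply/countable_injP; exists (f \o set_val) => x y _ _ /= /finj xy.
by apply: val_inj; apply: xy; rewrite inE; exact: set_valP.
Qed.

(** Continuity supplies open sets of the product topology, while product measures need the product
    of the Borel $\sigma$-algebras. Countable bases reconcile the two: an open set is the countable
    union of the basic rectangles that it contains. *)
Lemma second_countable_openX_measurable (A B : ptopologicalType) (U : set (A * B)) :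
  @second_countable A -> @second_countable B -> open U ->
  measurable (U : set (borel_of A * borel_of B)).
Proof.
move=> [BA cBA [oBA bA]] [BB cBB [oBB bB]] oU.
pose I := [set V : set A * set B | [/\ BA V.1, BB V.2 & V.1 `*` V.2 `<=` U]].
have -> : U = \bigcup_(V in I) (V.1 `*` V.2).
  apply/seteqP; split => [[x y] Uxy|xy [V [_ _ VU]]]; last exact: VU.
  move: (oU); rewrite openE => /(_ _ Uxy)[[P Q] /= [Px Qy] PQU].
  have [V [BV Vx] VP] := bA x _ Px; have [W [BW Wy] WQ] := bB y _ Qy.
  exists (V, W) => //; split => // -[a b] [/= Va Wb]; apply: PQU.
  by split; [exact: VP|exact: WQ].
apply: countable_bigcup_measurable.
  apply: (@sub_countable _ _ _ (BA `*` BB)); last exact: countableX.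
  by apply: subset_card_le => -[V W] [].
by move=> [V W] [/= BV BW _]; apply: measurableX; apply: open_measurable_borel;
  [exact: oBA|exact: oBB].
Qed.

Lemma measurable_fun_borel d (T : measurableType d) (X : ptopologicalType)
  (f : T -> borel_of X) :
  (forall U : set X, open U -> measurable (f @^-1` U)) -> measurable_fun setT f.
Proof.
move=> mf.
apply: (@measurability _ _ _ (borel_of X) _ _ (@open X : set (set (borel_of X)))) => //.
by move=> _ [U oU <-]; rewrite setTI; exact: mf.
Qed.

Lemma measurable_fun_real d (T : measurableType d) (R : realType) (f : T -> R) :
  (forall U : set R, open U -> measurable (f @^-1` U)) -> measurable_fun setT f.
Proof.
move=> mf; apply: (measurability _ (RGenOpens.measurableE R)).
by move=> _ [_ [a [b ->] <-]]; rewrite setTI; apply: mf; exact: interval_open.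
Qed.

Lemma continuous_borel_measurable (R : realType) (X : ptopologicalType) (f : X -> R) :
  continuous f -> measurable_fun [set: borel_of X] (f : borel_of X -> R).
Proof.
move=> /continuousP cf; apply: measurable_fun_real => U oU.
by apply: (@open_measurable_borel X); exact: cf.
Qed.

Lemma mdist_continuous2 (R : realType) (X : metricType R) :
  continuous (fun z : X * X => mdist z.1 z.2 : R).
Proof.
move=> [x y]; apply/cvgrPdist_lt => e e0.
near=> z.
have [zx zy] : mdist x z.1 < e / 2 /\ mdist y z.2 < e / 2.
  split; near: z.
    by apply: (metricType_numDomainType.cvgr_dist_lt (F := nbhs (x, y)) (f := fst));
      [exact: cvg_fst|rewrite divr_gt0].
  by apply: (metricType_numDomainType.cvgr_dist_lt (F := nbhs (x, y)) (f := snd));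
    [exact: cvg_snd|rewrite divr_gt0].
have h1 := metric_triangle x z.1 y.
(* With [h1], the three inequalities from here on give both signs of $|d(x,y)-d(z_1,z_2)|\le
   d(x,z_1)+d(y,z_2)$. *)
have h2 := metric_triangle z.1 z.2 y.
have h3 := metric_triangle z.1 x z.2.
have h4 := metric_triangle x y z.2.
move: h1 h2 h3 h4; rewrite (metric_sym z.1 x) (metric_sym z.2 y) => h1 h2 h3 h4.
by rewrite /= ltr_norml; apply/andP; split; lra.
Unshelve. all: by end_near. Qed.

Lemma mdist_continuous (R : realType) (X : metricType R) (x : X) :
  continuous (fun y : X => mdist x y : R).
Proof.
move=> y.
apply: (@continuous_comp _ _ _ (fun z : X => (x, z)) (fun z : X * X => mdist z.1 z.2 : R)).
  by apply: cvg_pair => //=; exact: cvg_cst.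
exact: mdist_continuous2.
Qed.

(** * Cozero sets, and measures determined by continuous functions *)

Lemma nat_inv_lt (R : realType) (e : R) : 0 < e -> exists k : nat, k.+1%:R^-1 < e.
Proof.
move=> e0; have [k _ /(_ _ (leqnn k))] := near_infty_natSinv_lt (PosNum e0).
by exists k.
Qed.

Lemma second_countable_dense (R : realType) (X : pointedMetricType R) :
  @second_countable X ->
  exists2 D : set X, countable D &
    forall (x : X) (e : R), 0 < e -> exists2 c, D c & mdist x c < e.
Proof.
move=> [B cB [oB bB]].
exists [set xget point V | V in B]; first exact: card_le_trans (card_image_le _ _) cB.
move=> x e e0; have [V [BV Vx] Ve] := bB x _ (nbhsx_ballx x e e0).
exists (xget point V); first by exists V.
by have := Ve _ (xgetI point Vx); rewrite ballEmdist.
Qed.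

(** A $\pi$-system of open sets whose indicators are pointwise limits of continuous functions; it
    links integrals of continuous functions to Borel measures. *)
Definition cozeros (R : realType) (X : topologicalType) : set (set X) :=
  [set A | exists2 h : X -> R, continuous h & A = [set x | 0 < h x]].

Lemma open_cozero (R : realType) (X : topologicalType) (A : set X) :
  @cozeros R X A -> open A.
Proof.
move=> [h /continuousP ch ->].
rewrite (_ : mkset _ = h @^-1` [set y | 0 < y]) //.
exact/ch/open_gt.
Qed.

(** Every open set is a countable union of balls with centre in a countable dense set and radius
    $1/(k+1)$, and such a ball is where $1/(k+1)-d(c,\cdot)$ is positive. *)
Lemma cozeros_generate (R : realType) (X : pointedMetricType R) :
  @second_countable X -> <<s @open X >> = <<s @cozeros R X >>.
Proof.
move=> /second_countable_dense[D cD dD]; apply/seteqP; split; last first.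
  by apply: sub_sigma_algebra2; exact: open_cozero.
apply: smallest_sub; first exact: smallest_sigma_algebra.
move=> U oU.
pose I := [set i : X * nat | D i.1 /\ ball i.1 (i.2.+1%:R^-1 : R) `<=` U].
have -> : U = \bigcup_(i in I) ball i.1 (i.2.+1%:R^-1 : R).
  apply/seteqP; split=> [x Ux|x [i [_ iU]]]; last exact: iU.
  have /(nbhs_ballP x)[e /= e0 eU] : nbhs x U by exact: open_nbhs_nbhs.
  (* Half of [e]: the chosen ball contains [x], so its points are within twice its radius of [x]. *)
  have [k ke] : exists k : nat, k.+1%:R^-1 < e / 2 by apply: nat_inv_lt; rewrite divr_gt0.
  have [c Dc xc] : exists2 c, D c & mdist x c < k.+1%:R^-1 by apply: dD; rewrite invr_gt0.
  exists (c, k) => /=; last by rewrite ballEmdist /= metric_sym xc.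
  split=> //= y; rewrite ballEmdist /= => cy; apply: eU; rewrite ballEmdist /=.
  by rewrite (le_lt_trans (metric_triangle x c y))// (splitr e) ltrD//; exact: lt_trans ke.
apply: (@countable_bigcup_measurable _ (g_sigma_algebraType (@cozeros R X))).
  apply: (@sub_countable _ _ _ (D `*` [set: nat])); last exact: countableX.
  by apply: subset_card_le => -[c k] [].
move=> [c k] _; apply: sub_sigma_algebra.
exists (fun x => k.+1%:R^-1 - mdist c x).
  by move=> x; apply: cvgB; [exact: cvg_cst|exact: mdist_continuous].
by apply/seteqP; split=> x /=; rewrite ballEmdist /= subr_gt0.
Qed.

Lemma cozeros_setI (R : realType) (X : topologicalType) : setI_closed (@cozeros R X).
Proof.
move=> _ _ [h ch ->] [g cg ->]; exists (h \min g).
  exact: min_fun_continuous.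
by apply/seteqP; split=> x /=; rewrite lt_min => /andP.
Qed.

(** Takes values in $[0,1]$ and increases with [n] to the indicator of $\{h>0\}$. *)
Definition cozero_approx (R : realType) (X : Type) (h : X -> R) (n : nat) (x : X) : R :=
  Num.min 1 (n%:R * Num.max 0 (h x)).

Lemma cozero_approx_continuous (R : realType) (X : topologicalType) (h : X -> R) n :
  continuous h -> continuous (cozero_approx h n).
Proof.
move=> ch; apply: (@min_fun_continuous _ _ R (cst 1)); first exact: cst_continuous.
move=> x; apply: cvgM; first exact: cvg_cst.
by apply: (@max_fun_continuous _ _ R (cst 0) h) => //; exact: cst_continuous.
Qed.

Lemma cozero_approx_integral_cvg (R : realType) (X : pointedMetricType R)
  (m : probability (borel_of X) R) (h : X -> R) : continuous h ->
  (fun n => \int[m]_(x in [set: borel_of X]) (cozero_approx h n x)%:E)%E @ \oo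
    --> m [set x | 0 < h x].
Proof.
move=> ch; set A := mkset _.
have mA : measurable (A : set (borel_of X)).
  by apply: open_measurable_borel; apply: (@open_cozero R); exists h.
rewrite -[A]setIT -(@integral_indic _ _ _ m _ measurableT (A : set (borel_of X)))//.
have [] := @dominated_convergence _ (borel_of X) R m setT measurableT
  (fun n x => (cozero_approx h n x)%:E) (fun x => (\1_A x)%:E) (cst 1%E).
- move=> n; apply/measurable_EFinP; apply: continuous_borel_measurable.
  exact: cozero_approx_continuous.
- exact/measurable_EFinP.
- apply: aeW => x _; apply: cvg_EFin; first by near=> n.
  rewrite /cozero_approx indicE.
  have [hx|hx] := leP (h x) 0.
    rewrite memNset; last by apply/negP; rewrite -leNgt.
    rewrite (_ : (fun _ => _) = cst 0); first exact: cvg_cst.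
    by apply/funext => n /=; rewrite mulr0 min_r.
  (* For $h(x)>0$ the sequence is constantly $1$ from $n\ge 1/h(x)$ on. *)
  rewrite mem_set//; apply: cvg_near_cst; near=> n; rewrite /=.
  rewrite min_l// -ler_pdivrMr// div1r.
  by near: n; exact: nbhs_infty_ger.
- exact: finite_measure_integrable_cst.
- apply: aeW => x n _ /=; rewrite lee_fin /cozero_approx ger0_norm.
    by rewrite ge_min lexx.
  by rewrite le_min ler01 mulr_ge0// le_max lexx.
by move=> _ _.
Unshelve. all: by end_near. Qed.

(** Integrals of [cozero_approx] pass to the limit, so the measures agree on cozero sets, a
    generating $\pi$-system. *)
Lemma probability_eq_continuous (R : realType) (X : pointedMetricType R)
  (m1 m2 : probability (borel_of X) R) : @second_countable X ->
  (forall f : X -> R, continuous f ->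
    \int[m1]_(x in [set: borel_of X]) (f x)%:E =
    \int[m2]_(x in [set: borel_of X]) (f x)%:E)%E ->
  forall B, measurable B -> m1 B = m2 B.
Proof.
move=> scX mE B mB.
apply: (@measure_unique _ _ (borel_of X) (@cozeros R X) (fun=> setT)) => //.
- exact: cozeros_generate.
- exact: cozeros_setI.
- move=> _; exists (fun=> 1); first by move=> ?; exact: cvg_cst.
  by apply/seteqP; split => x //=.
- by apply: bigcup_const; exists 0%N.
- move=> _ [h ch ->].
  have c1 := cozero_approx_integral_cvg (m:=m1) ch.
  have c2 := cozero_approx_integral_cvg (m:=m2) ch.
  apply: (cvg_unique _ c1) => //.
  rewrite (_ : (fun n => _) =
    (fun n => \int[m2]_(x in [set: borel_of X]) (cozero_approx h n x)%:E)%E) //.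
  by apply/funext => n; apply: mE; exact: cozero_approx_continuous.
- by move=> _; apply: (@le_lt_trans _ _ 1%E); [exact: (@probability_le1 _ _ _ m1)|exact: ltry].
Qed.

(** * Finite compositions: prepending a letter, nested images, continuity *)

Definition scons (L : Type) (l : L) (s : nat -> L) : nat -> L :=
  fun n => if n is m.+1 then s m else l.

(** [comp_n] grows on the inside, whereas a prepended letter acts on the outside; both the transfer
    recursion and the cocycle identity come from this. *)
Lemma comp_n_scons (L X : Type) (w : L * X -> X) l s n x :
  comp_n w (scons l s) n.+1 x = w (l, comp_n w s n x).
Proof. by elim: n x => [//|n IHn] x; rewrite /= -IHn. Qed.

Lemma comp_n_image_nested (L X : Type) (w : L * X -> X) s m n : (m <= n)%N ->
  comp_n w s n @` setT `<=` comp_n w s m @` setT.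
Proof.
elim: n => [|n IHn]; first by rewrite leqn0 => /eqP ->.
rewrite leq_eqVlt ltnS => /predU1P[->//|/IHn]; apply: subset_trans.
by move=> _ [x _ <-]; exists (w (s n, x)).
Qed.

Lemma continuous_section (L X Y : topologicalType) (f : L * X -> Y) (l : L) :
  continuous f -> continuous (fun x => f (l, x)).
Proof.
move=> cf x; apply: (@continuous_comp _ _ _ (fun z : X => (l, z)) f); last exact: cf.
by apply: cvg_pair => //=; exact: cvg_cst.
Qed.

Lemma comp_n_continuous (L X : topologicalType) (w : L * X -> X) s n :
  continuous w -> continuous (comp_n w s n).
Proof.
move=> cw; elim: n => [|n IHn] x; first exact: cvg_id.
apply: (@continuous_comp _ _ _ (fun x => w (s n, x)) (comp_n w s n)).
  exact: continuous_section.
exact: IHn.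
Qed.

(** * Distances and diameters in a compact metric space *)

Section metric.
Variables (R : realType) (X : metricType R).
Implicit Types (A : set X).

Lemma compact_mdist_bounded : compact [set: X] -> exists M : R, forall x y : X, mdist x y <= M.
Proof.
move=> cX; have [[x0 _]|noX] := pselect (exists x : X, True); last first.
  by exists 0 => x; case: noX; exists x.
have cXX : compact ([set: X] `*` [set: X]) by exact: compact_setX.
have [||[c d] _ cP] := @compact_EVT_max _ R (fun z : X * X => mdist z.1 z.2) _ _ cXX.
- by exists (x0, x0).
- by apply: continuous_subspaceT => ?; exact: mdist_continuous2.
by exists (mdist c d) => x y; apply: (cP (x, y)); rewrite inE.
Qed.

(** Compactness bounds the set of distances, so that the real [sup] in [Diam] is a true least upper
    bound. *)
Lemma le_Diam A (x y : X) : compact [set: X] -> A x -> A y -> mdist x y <= Diam A.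
Proof.
move=> /compact_mdist_bounded[M MP] Ax Ay; apply: sup_ubound; last by exists x, y.
by exists M => _ [a [b [_ _ ->]]].
Qed.

Lemma Diam_le A (x : X) (r : R) : A x -> (forall x y, A x -> A y -> mdist x y <= r) ->
  Diam A <= r.
Proof.
move=> Ax Ar; apply: sup_le_ub; first by exists (mdist x x), x, x.
by move=> _ [a [b [Aa Ab ->]]]; exact: Ar.
Qed.

Lemma mdist_small_eq (x y : X) : (forall e : R, 0 < e -> mdist x y < e) -> x = y.
Proof.
move=> xy; apply: mdist_positivity; apply/eqP; rewrite eq_le mdist_ge0 andbT.
by apply/ler_addgt0Pl => e e0; rewrite addr0 ltW// xy.
Qed.

(** The tube lemma: compactness of [Y] turns continuity at each $(l_0,y)$ into one neighbourhood of
    $l_0$ that serves all [y]. *)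
Lemma mdist_near_uniform (L Y : topologicalType) (f : L * Y -> X) l0 (e : R) :
  compact [set: Y] -> continuous f -> 0 < e ->
  \forall l \near l0, forall y, mdist (f (l0, y)) (f (l, y)) < e.
Proof.
move=> cY cf e0.
suff : \forall l \near l0, [set: Y] `<=` (fun y => mdist (f (l0, y)) (f (l, y)) < e).
  by apply: filterS => l lP y; exact: lP.
have /compact_near_coveringP cov := cY.
apply: cov => y _.
have e20 : 0 < e / 2 by rewrite divr_gt0.
have := metricType_numDomainType.cvgr_dist_lt (cf (l0, y)) e20.
move=> [[P Q] /= [Pl Qy] PQ].
exists (Q, P) => //= -[y' l] /= [Qy' Pl'].
(* Both values are compared with the one at the centre $(l_0,y)$ of the covering box. *)
have h1 := PQ (l, y') (conj Pl' Qy').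
have h2 := PQ (l0, y') (conj (nbhs_singleton Pl) Qy').
rewrite /= (le_lt_trans (metric_triangle _ (f (l0, y)) _))//.
by rewrite (splitr e) ltrD// metric_sym.
Qed.

End metric.

(** * The coding map [Gamma] and stability of finite compositions *)

Section ifs.
Variables (R : realType) (X L : pointedMetricType R) (w : L * X -> X).
Hypotheses (cX : compact [set: X]) (cw : continuous w).
Implicit Types (s : nat -> L).

Let K s n := comp_n w s n @` [set: X].

Let K_nested s m n z : (m <= n)%N -> K s n z -> K s m z.
Proof. by move=> mn; exact: comp_n_image_nested. Qed.

(** Removes the limit and the supremum: since the images are nested, a single good [n] suffices for
    each [k]. The measurability of [S_hyp w] is proved from this form. *)
Lemma S_hypP s : S_hyp w s <-> forall k, exists n, forall x y,
  mdist (comp_n w s n x) (comp_n w s n y) <= k.+1%:R^-1.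
Proof.
split=> [Ss k|Ss].
  have : 0 < k.+1%:R^-1 :> R by rewrite invr_gt0.
  move/cvgrPdist_lt : Ss => /[apply] -[n _ /(_ n (leqnn n))].
  rewrite sub0r normrN => nk; exists n => x y; apply: le_trans (ltW nk).
  by apply: le_trans (ler_norm _); apply: le_Diam.
apply/cvgrPdist_lt => e e0; have [k ke] := nat_inv_lt e0.
have [n nP] := Ss k; exists n => // m /= nm; rewrite sub0r normrN.
have K0 : K s m (comp_n w s m point) by exists point.
rewrite ger0_norm; last exact: le_trans (mdist_ge0 _ _) (le_Diam cX K0 K0).
apply: le_lt_trans ke; apply: (Diam_le K0).
move=> x y /(K_nested nm)[a _ <-] /(K_nested nm)[b _ <-].
exact: nP.
Qed.

Lemma S_hyp_lt s (e : R) : S_hyp w s -> 0 < e ->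
  exists N, forall n x y, (N <= n)%N -> K s n x -> K s n y -> mdist x y < e.
Proof.
move=> /S_hypP Ss e0; have [k ke] := nat_inv_lt e0; have [N NP] := Ss k.
exists N => n x y Nn /(K_nested Nn)[a _ <-] /(K_nested Nn)[b _ <-].
exact: le_lt_trans (NP _ _) ke.
Qed.

Definition Gamma s : X := xget point [set z | forall n, K s n z].

(** A common point exists by compactness: a cluster point of the sequence [comp_n w s n point]
    works, since each image is closed and contains a tail of that sequence. *)
Lemma Gamma_mem s : forall n, K s n (Gamma s).
Proof.
suff : (\bigcap_n K s n) !=set0.
  by move=> [z zP]; apply: (@xgetI _ point [set z | forall n, K s n z] z) => n; exact: zP.
have [z [_ zP]] := cX (F := (fun n => comp_n w s n point) @ \oo) _ filterT.
exists z => n _; have cK : closed (K s n).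
  apply: compact_closed; first exact: metric_hausdorff.
  apply: continuous_compact => //; apply: continuous_subspaceT => ?.
  exact: comp_n_continuous.
apply: cK; move: zP; rewrite clusterE; apply; exists n => // m /= nm.
by apply: (comp_n_image_nested nm); exists point.
Qed.

Lemma Gamma_unique s z : S_hyp w s -> (forall n, K s n z) -> Gamma s = z.
Proof.
move=> Ss zP; apply: mdist_small_eq => e e0.
have [N NP] := S_hyp_lt Ss e0; apply: (NP N) => //; exact: Gamma_mem.
Qed.

Lemma Gamma_imgE : Gamma_img w = Gamma @` S_hyp w.
Proof.
apply/seteqP; split=> [x [s Ss xP]|_ [s Ss <-]]; exists s => //.
  exact: Gamma_unique.
exact: Gamma_mem.
Qed.

(** The limit and the [n]-th point both lie in the [n]-th image, whose diameter tends to zero. *)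
Lemma comp_n_cvg_Gamma s x : S_hyp w s -> comp_n w s n x @[n --> \oo] --> Gamma s.
Proof.
move=> Ss; apply/metricType_numDomainType.cvgrPdist_lt => e e0.
have [N NP] := S_hyp_lt Ss e0; exists N => // n /= Nn.
by apply: (NP n) => //; [exact: Gamma_mem|exists x].
Qed.

(** Applying [w (l, _)] to a point common to all images along [s] gives a point common to all images
    along [scons l s], and the latter is unique. *)
Lemma Gamma_scons l s : S_hyp w (scons l s) -> Gamma (scons l s) = w (l, Gamma s).
Proof.
move=> Sls; apply: Gamma_unique => // -[|n]; first by exists (w (l, Gamma s)).
by have [x _ <-] := Gamma_mem s n; exists x => //; rewrite comp_n_scons.
Qed.

(** Supplies the cylinder around [s] for the support argument. By induction, the error [e] is shared
    between the innermost letter and all the outer ones. *)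
Lemma comp_n_near s n (e : R) : 0 < e ->
  exists2 V : nat -> set L, (forall i, open (V i) /\ V i (s i)) &
    forall s', (forall i, (i < n)%N -> V i (s' i)) ->
    forall x, mdist (comp_n w s n x) (comp_n w s' n x) < e.
Proof.
elim: n e => [|n IHn] e e0.
  exists (fun=> setT) => [i|s' _ x]; first by split => //; exact: openT.
  by rewrite /= mdistxx.
have e20 : 0 < e / 2 by rewrite divr_gt0.
have [V Vs VP] := IHn _ e20.
have cwn : continuous (comp_n w s n \o w).
  by move=> ?; apply: continuous_comp; [exact: cw|exact: comp_n_continuous].
have := mdist_near_uniform (s n) cX cwn e20.
rewrite /prop_near1 nbhsE => -[W [oW Ws] WP].
(* Letter [n] is confined to [W]; the other letters keep their sets from the induction
   hypothesis. *)
exists (fun i => if i == n then W else V i) => [i|s' s'P x].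
  by case: eqVneq => [->|_]; [split|exact: Vs].
(* At the intermediate point the innermost letter is already that of [s'], the outer ones still
   those of [s]. *)
rewrite /= (le_lt_trans (metric_triangle _ (comp_n w s n (w (s' n, x))) _))//.
rewrite (splitr e) ltrD//.
  by apply: WP; have := s'P n (ltnSn n); rewrite eqxx.
by apply: VP => i ni; have := s'P i (ltnW ni); rewrite ltn_eqF.
Qed.

End ifs.

(** * Measurability on the sequence space *)

Lemma coordinate_measurable (L : ptopologicalType) n :
  measurable_fun [set: Omega L] (fun s : Omega L => (s : nat -> borel_of L) n).
Proof.
move=> _ B mB; rewrite setTI; apply: sub_sigma_algebra.
by exists n; exists B.
Qed.

Lemma measurable_fun_Omega d (T : measurableType d) (L : ptopologicalType)
  (f : T -> Omega L) :
  (forall n, measurable_fun [set: T] (fun t => (f t : nat -> borel_of L) n)) ->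
  measurable_fun [set: T] f.
Proof.
move=> mf; apply: (@measurability _ _ _ (Omega L) _ _ (@cylinders L)) => //.
move=> _ [_ [n [B mB ->]] <-].
exact: (mf n measurableT B mB).
Qed.

Lemma scons_measurable (L : ptopologicalType) :
  measurable_fun [set: borel_of L * Omega L]
    (fun z : borel_of L * Omega L => scons z.1 z.2 : Omega L).
Proof.
apply: measurable_fun_Omega => -[|n]; first exact: measurable_fst.
have msnd : measurable_fun [set: borel_of L * Omega L] snd by exact: measurable_snd.
exact: (measurableT_comp (coordinate_measurable n) msnd).
Qed.

Section measurability.
Variables (R : realType) (X L : pointedMetricType R) (w : L * X -> X).
Hypotheses (cX : compact [set: X]) (cL : compact [set: L]) (cw : continuous w).

Let scX : @second_countable X := compact_second_countable cX.
Let scL : @second_countable L := compact_second_countable cL.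

Lemma w_measurable :
  measurable_fun [set: borel_of L * borel_of X]
    (w : borel_of L * borel_of X -> borel_of X).
Proof.
apply: measurable_fun_borel => U oU; apply: second_countable_openX_measurable => //.
by move/continuousP : cw; exact.
Qed.

Lemma comp_n_measurable n :
  measurable_fun [set: Omega L * borel_of X]
    (fun z : Omega L * borel_of X => comp_n w z.1 n z.2 : borel_of X).
Proof.
elim: n => [|n IHn]; first exact: measurable_snd.
(* The inner step is written as a map of pairs that keeps [s], so that the induction hypothesis can
   be composed with it. *)
have mwn : measurable_fun [set: Omega L * borel_of X]
    (fun z : Omega L * borel_of X => (z.1, w (z.1 n, z.2)) : Omega L * borel_of X).
  apply: measurable_fun_pair; first exact: measurable_fst.
  apply: (measurableT_comp w_measurable); apply: measurable_fun_pair.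
    have mfst : measurable_fun [set: Omega L * borel_of X] fst by exact: measurable_fst.
    exact: (measurableT_comp (coordinate_measurable n) mfst).
  exact: measurable_snd.
exact: (measurableT_comp IHn mwn).
Qed.

Lemma comp_n_section_measurable n x :
  measurable_fun [set: Omega L] (fun s : Omega L => comp_n w s n x : borel_of X).
Proof.
have mx : measurable_fun [set: Omega L] (fun s => (s, x) : Omega L * borel_of X).
  by apply: measurable_fun_pair; [exact: measurable_id|exact: measurable_cst].
exact: (measurableT_comp (comp_n_measurable n) mx).
Qed.

Lemma mdist_comp_n_measurable n x y (r : R) :
  measurable [set s : Omega L | r < mdist (comp_n w s n x) (comp_n w s n y)].
Proof.
have mxy : measurable_fun [set: Omega L]
    (fun s => (comp_n w s n x, comp_n w s n y) : borel_of X * borel_of X).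
  by apply: measurable_fun_pair; exact: comp_n_section_measurable.
have oU : open [set z : X * X | r < mdist z.1 z.2].
  have /continuousP c2 := @mdist_continuous2 R X.
  exact: (c2 _ (@open_gt _ r)).
have := mxy measurableT _ (second_countable_openX_measurable scX scX oU).
by rewrite setTI.
Qed.

(** For fixed [n], being separated by more than $1/(k+1)$ is an open condition on each of the two
    points, so it can be tested on a countable dense set. *)
Lemma S_hyp_measurable : measurable (S_hyp w : set (Omega L)).
Proof.
have [D cD dD] := second_countable_dense scX.
have denseD (U : set X) x : open U -> U x -> exists2 c, D c & U c.
  move=> oU Ux; have /(nbhs_ballP x)[e /= e0 eU] : nbhs x U by exact: open_nbhs_nbhs.
  by have [c Dc xc] := dD x e e0; exists c => //; apply: eU; rewrite ballEmdist.
(* The event that some pair of dense points has [n]-th images more than $1/(k+1)$ apart. *)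
pose Z k n := \bigcup_(c in D `*` D)
  [set s : Omega L | k.+1%:R^-1 < mdist (comp_n w s n c.1) (comp_n w s n c.2) :> R].
have -> : S_hyp w = \bigcap_k \bigcup_n ~` Z k n.
  apply/seteqP; split => [s /(S_hypP w cX) Ss k _|s Ss].
    have [n nP] := Ss k; exists n => // -[[x y] _] /=.
    by rewrite ltNge nP.
  apply/(S_hypP w cX) => k; have [n _ nZ] := Ss k I; exists n => x y.
  rewrite leNgt; apply/negP => xy; apply: nZ.
  have cn : continuous (comp_n w s n) by exact: comp_n_continuous.
  have ogt c : open [set y' | k.+1%:R^-1 < mdist (comp_n w s n c) (comp_n w s n y')].
    have /continuousP c1 :
        continuous (fun y' => mdist (comp_n w s n c) (comp_n w s n y') : R).
      move=> z.
      apply: (@continuous_comp _ _ _ (comp_n w s n) (mdist (comp_n w s n c) : X -> R)).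
        exact: cn.
      exact: mdist_continuous.
    exact: (c1 [set t | k.+1%:R^-1 < t] (@open_gt _ _)).
  (* The pair moves into [D] one coordinate at a time: first [y] to [d], then [x] to [c]. *)
  have [d Dd xd] := denseD _ _ (ogt x) xy.
  have [|c Dc cd] := denseD _ x (ogt d); first by rewrite /= metric_sym.
  by exists (d, c) => //; split.
apply: bigcap_measurable => // k _; apply: bigcup_measurable => n _.
apply/measurableC/countable_bigcup_measurable; first exact: countableX.
by move=> c _; exact: mdist_comp_n_measurable.
Qed.

(* Off S_hyp, Gamma is an arbitrary choice of a common point; it is reset there to
   a constant to get a measurable map. *)
Definition GammaS (s : nat -> L) : X := if s \in S_hyp w then Gamma w s else point.

Lemma GammaS_E s : S_hyp w s -> GammaS s = Gamma w s.
Proof. by move=> Ss; rewrite /GammaS mem_set. Qed.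

(** Testing on cozero sets reduces the question to the real functions [h \o GammaS], which are
    pointwise limits of measurable ones. *)
Lemma GammaS_measurable :
  measurable_fun [set: Omega L] (GammaS : Omega L -> borel_of X).
Proof.
apply: (@measurability _ _ _ (borel_of X) _ _ (@cozeros R X)).
  exact: cozeros_generate.
move=> _ [_ [h ch ->] <-].
(* Equal to [point] off [S_hyp w], so that convergence to [GammaS] holds at every sequence. *)
pose G n (s : Omega L) : borel_of X := if s \in S_hyp w then comp_n w s n point else point.
have mS : measurable_fun [set: Omega L] (fun s : Omega L => s \in (S_hyp w : set (Omega L))).
  apply: (measurable_fun_bool true); rewrite setTI.
  rewrite (_ : _ @^-1` _ = S_hyp w); first exact: S_hyp_measurable.
  by apply/seteqP; split => s /=; [exact: set_mem|exact: mem_set].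
have mh : measurable_fun [set: Omega L] (h \o GammaS : Omega L -> R).
  apply: (@measurable_fun_cvg _ _ _ _ (fun n s => h (G n s))).
    move=> n; apply: (measurableT_comp (continuous_borel_measurable ch)).
    apply: measurable_fun_ifT => //.
    exact: comp_n_section_measurable.
  move=> s _; rewrite /G /= /GammaS; case: ifPn => [/set_mem Ss|_]; last exact: cvg_cst.
  apply: (cvg_comp _ _ (comp_n_cvg_Gamma cX cw point Ss)).
  exact: ch.
rewrite setTI (_ : _ @^-1` _ = (h \o GammaS) @^-1` [set t | 0 < t]) //.
rewrite -[X in measurable X]setTI; apply: mh => //.
apply: open_measurable; exact: (@open_gt _ 0).
Qed.

End measurability.

(** * Image measures and almost sure events *)

Definition push d d' (T : measurableType d) (T' : measurableType d') (R : realType)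
  (m : probability T R) (f : T -> T') (mf : measurable_fun [set: T] f) :
  probability T' R := distribution m (mfun_Sub (mem_set mf)).

Lemma pushE d d' (T : measurableType d) (T' : measurableType d') (R : realType)
  (m : probability T R) (f : T -> T') (mf : measurable_fun [set: T] f) A :
  push m mf A = m (f @^-1` A).
Proof. by []. Qed.

Lemma integral_push d d' (T : measurableType d) (T' : measurableType d') (R : realType)
  (m : probability T R) (f : T -> T') (mf : measurable_fun [set: T] f) (g : T' -> \bar R) :
  measurable_fun [set: T'] g -> m.-integrable [set: T] (g \o f) ->
  (\int[push m mf]_(y in [set: T']) g y = \int[m]_(x in [set: T]) g (f x))%E.
Proof. by move=> mg ig; rewrite integral_distribution. Qed.

Lemma ge0_integral_push d d' (T : measurableType d) (T' : measurableType d') (R : realType)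
  (m : probability T R) (f : T -> T') (mf : measurable_fun [set: T] f) (g : T' -> \bar R) :
  measurable_fun [set: T'] g -> (forall y, 0 <= g y)%E ->
  (\int[push m mf]_(y in [set: T']) g y = \int[m]_(x in [set: T]) g (f x))%E.
Proof. by move=> mg g0; rewrite ge0_integral_distribution. Qed.

(** What is left of [A] lies in the null complement of [S]. This allows [GammaS] to be replaced by
    [Gamma] inside probabilities. *)
Lemma probability_setIr1 d (T : measurableType d) (R : realType)
  (m : probability T R) (A S : set T) :
  measurable A -> measurable S -> m S = 1%E -> m (A `&` S) = m A.
Proof.
move=> mA mS mS1; rewrite [RHS](measureDI m mA mS).
rewrite [X in (X + _)%E](_ : _ = 0%E) ?add0e//.
apply: (subset_measure0 (mu := m) (B := ~` S)); rewrite ?subDsetr//.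
- exact: measurableD.
- exact: measurableC.
- by have := probability_setC m mS; rewrite mS1 subee.
Qed.

(** * Invariance of the Bernoulli measure under prepending a random letter *)

Section bernoulli.
Variables (R : realType) (L : ptopologicalType).
Variables (p : probability (borel_of L) R) (P : probability (Omega L) R).
Hypothesis prodP : is_product_measure p P.

Definition box n (B : nat -> set (borel_of L)) : set (Omega L) :=
  [set s : Omega L | forall i, (i < n)%N -> B i (s i)].

Definition boxes : set (set (Omega L)) :=
  [set A | exists n, exists2 B : nat -> set (borel_of L),
     forall i, measurable (B i) & A = box n B].

Lemma box_bigcap n B : box n B =
  \bigcap_(i in [set i | (i < n)%N])
    (fun s : Omega L => (s : nat -> borel_of L) i) @^-1` (B i).
Proof. by apply/seteqP; split => s sB i /=; [exact: (sB i)|exact: (sB i)]. Qed.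

Lemma boxes_measurable A : boxes A -> measurable A.
Proof.
move=> [n [B mB ->]]; rewrite box_bigcap; apply: bigcap_measurableType => i _.
rewrite -[X in measurable X]setTI.
exact: (coordinate_measurable (L:=L) i measurableT (mB i)).
Qed.

Lemma boxes_setI : setI_closed boxes.
Proof.
move=> _ _ [m [B mB ->]] [n [C mC ->]].
exists (maxn m n).
(* Beyond its own length each box is padded with [setT]. *)
exists (fun i => (if (i < m)%N then B i else setT) `&` (if (i < n)%N then C i else setT)).
  by move=> i; apply: measurableI; case: ifP.
apply/seteqP; split => [s [sB sC] i _|s sBC].
  by split; case: ifP => // ?; [exact: sB|exact: sC].
split=> i im.
  by have [] := sBC i; rewrite ?leq_max ?im// => ? _.
by have [] := sBC i; rewrite ?leq_max ?im ?orbT// => _.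
Qed.

Lemma boxes_generate : @measurable _ (Omega L) = <<s boxes >>.
Proof.
apply/seteqP; split.
  apply: smallest_sub; first exact: smallest_sigma_algebra.
  move=> _ [n [B mB ->]]; apply: sub_sigma_algebra.
  (* A constraint on coordinate [n] alone is a box of length [n.+1] with full sets before [n]. *)
  exists n.+1, (fun i => if i == n then B else setT).
    by move=> i; case: ifP.
  apply/seteqP; split => [s sB i _|s sB].
    by case: eqVneq => [->|].
  by have := sB n (ltnSn n); rewrite eqxx.
apply: smallest_sub; first exact: sigma_algebra_measurable.
exact: boxes_measurable.
Qed.

Lemma product_scons_box n B : (forall i, measurable (B i)) ->
  (p \x P)%E ((fun z : borel_of L * Omega L => scons z.1 z.2 : Omega L) @^-1` box n B)
  = (\prod_(i < n) p (B i))%E.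
Proof.
move=> mB; case: n => [|n].
  rewrite big_ord0 (_ : _ @^-1` _ = setT) ?probability_setT//.
  by apply/seteqP; split.
rewrite big_ord_recl (_ : _ @^-1` _ = B 0%N `*` box n (fun i => B i.+1)); last first.
  apply/seteqP; split => [[l s] sB|[l s] [/= Bl sB] [|i] //]; last exact: sB.
  by split; [exact: (sB 0%N)|move=> i ni; exact: (sB i.+1)].
rewrite product_measure1E//; last by apply: boxes_measurable; exists n, (fun i => B i.+1).
by congr (_ * _)%E; exact: (prodP n (fun i => mB i.+1)).
Qed.

(** Both measures agree on boxes, a generating $\pi$-system: the preimage of a nontrivial box is the
    product of its first side with the box of the remaining ones. *)
Lemma push_scons A : measurable A ->
  (p \x P)%E ((fun z : borel_of L * Omega L => scons z.1 z.2 : Omega L) @^-1` A) = P A.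
Proof.
move=> mA; rewrite -(pushE _ (scons_measurable (L:=L))).
apply: (@measure_unique _ _ (Omega L) boxes (fun=> setT)) => //.
- exact: boxes_generate.
- exact: boxes_setI.
- move=> _; exists 0%N, (fun=> setT) => //.
  by apply/seteqP; split.
- by apply: bigcup_const; exists 0%N.
- move=> _ [n [B mB ->]]; transitivity (\prod_(i < n) p (B i))%E; last exact/esym/prodP.
  exact: product_scons_box.
- by move=> _; apply: (@le_lt_trans _ _ 1%E); [|exact: ltry];
    exact: (@probability_le1 _ _ _ (push (p \x P)%E (scons_measurable (L:=L)))).
Qed.

End bernoulli.

(** * Auxiliary facts on product measures and bounded functions *)

Lemma product_measure_XT d d' (T : measurableType d) (T' : measurableType d')
  (R : realType) (m : probability T R) (m' : probability T' R) (A : set T) :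
  measurable A -> (m \x m')%E (A `*` setT) = m A.
Proof.
move=> mA; rewrite [LHS](product_measure1E m m' mA measurableT).
by rewrite [X in (_ * X)%E](probability_setT m') mule1.
Qed.

Lemma continuous_bounded (R : realType) (X : topologicalType) (f : X -> R) :
  compact [set: X] -> continuous f -> exists M, forall x, `|f x| <= M.
Proof.
move=> cX cf; have [[x0 _]|noX] := pselect (exists x : X, True); last first.
  by exists 0 => x; case: noX; exists x.
have [||c _ cP] := @compact_EVT_max _ R (fun x => `|f x|) _ _ cX.
- by exists x0.
- by apply: continuous_subspaceT => x; apply: cvg_norm; exact: cf.
by exists `|f c| => x; apply: cP; rewrite inE.
Qed.

Lemma bounded_integrable d (T : measurableType d) (R : realType)
  (m : probability T R) (g : T -> R) (M : R) :
  measurable_fun [set: T] g -> (forall x, `|g x| <= M) ->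
  m.-integrable [set: T] (EFin \o g).
Proof.
move=> mg gM; apply: measurable_bounded_integrable => //.
  by apply: (@le_lt_trans _ _ 1%E); [exact: probability_le1|exact: ltry].
by exists M; split; [exact: num_real|move=> M' MM' x _ /=; exact: le_trans (ltW MM')].
Qed.

(** * Dynamics of the transfer operator: convergence, fixed point, support *)

Section dynamics.
Variables (R : realType) (X L : pointedMetricType R) (w : L * X -> X).
Variables (p : probability (borel_of L) R) (P : probability (Omega L) R).
Hypotheses (cX : compact [set: X]) (cL : compact [set: L]) (cw : continuous w).
Hypotheses (prodP : is_product_measure p P) (PS : P (S_hyp w) = 1%E).

Let mS : measurable (S_hyp w : set (Omega L)) := S_hyp_measurable cX cL cw.

Lemma w_section_measurable l (B : set (borel_of X)) :
  measurable B -> measurable ((fun x : borel_of X => w (l, x) : borel_of X) @^-1` B).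
Proof.
move=> mB.
have mw : measurable_fun [set: borel_of X] (fun x : borel_of X => w (l, x) : borel_of X).
  apply: measurable_fun_borel => U oU; apply: open_measurable_borel.
  by have /continuousP := @continuous_section _ _ _ _ l cw; exact.
by have := mw measurableT B mB; rewrite setTI.
Qed.

Lemma eq_transfer (m1 m2 : set (borel_of X) -> \bar R) :
  (forall B, measurable B -> m1 B = m2 B) ->
  forall B, measurable B -> transfer w p m1 B = transfer w p m2 B.
Proof.
by move=> m12 B mB; apply: eq_integral => l _; apply: m12; exact: w_section_measurable.
Qed.

Definition orbit_law (nu : probability (borel_of X) R) n : probability (borel_of X) R :=
  push (P \x nu)%E (comp_n_measurable cX cL cw n).

Lemma orbit_law0 nu B : measurable B -> orbit_law nu 0%N B = nu B.
Proof.
move=> mB; rewrite /orbit_law pushE.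
rewrite (_ : _ @^-1` _ = setT `*` B); last by apply/seteqP; split => -[s x] //= [].
rewrite [LHS](product_measure1E P nu measurableT mB).
by rewrite [X in (X * _)%E](probability_setT P) mul1e.
Qed.

(** Replacing [P] by the law of [scons l s] and applying Tonelli isolates the first letter [l]; its
    map acts outermost, so the inner integral is the value of [orbit_law nu n] at
    $\omega_l^{-1}(B)$. *)
Lemma orbit_lawS nu n B : measurable B ->
  orbit_law nu n.+1 B = transfer w p (orbit_law nu n) B.
Proof.
move=> mB.
pose A := (fun z : Omega L * borel_of X => comp_n w z.1 n.+1 z.2 : borel_of X) @^-1` B.
have mA : measurable A.
  by rewrite -[A]setTI; exact: (comp_n_measurable cX cL cw n.+1 measurableT mB).
pose F := (nu \o xsection A : Omega L -> \bar R).
have mF : measurable_fun [set: Omega L] F by exact: measurable_fun_xsection.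
have F0 s : (0 <= F s)%E by exact: measure_ge0.
(* The product measure is by definition the integral of the measures of sections. *)
transitivity (\int[P]_s F s)%E => //.
rewrite (eq_measure_integral (push (p \x P)%E (scons_measurable (L:=L)))); last first.
  by move=> C mC _; exact/esym/push_scons.
rewrite ge0_integral_push// fubini_tonelli1//; last first.
  exact: measurableT_comp mF (scons_measurable (L:=L)).
apply: eq_integral => l _; apply: eq_integral => s _.
rewrite /F /=; congr (nu _).
have E x : A (scons l s, x) = B (w (l, comp_n w s n x)).
  by congr (B _); exact: comp_n_scons.
by apply/seteqP; split => x; rewrite /xsection /= !inE E.
Qed.

Definition limit_law : probability (borel_of X) R :=
  push P (GammaS_measurable cX cL cw).

Lemma orbit_law_cvg nu : weak_star_cvg (orbit_law nu) limit_law.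
Proof.
move=> f cf; have [M fM] := continuous_bounded cX cf.
have mf := continuous_borel_measurable cf.
have mfE : measurable_fun [set: borel_of X] (fun x => (f x)%:E) by exact/measurable_EFinP.
have mG : measurable_fun [set: Omega L * borel_of X]
    (fun z : Omega L * borel_of X => GammaS w z.1 : borel_of X).
  exact: (measurableT_comp (GammaS_measurable cX cL cw) measurable_fst).
have iE (g : Omega L * borel_of X -> borel_of X) (mg : measurable_fun setT g) :
    (\int[push (P \x nu)%E mg]_y (f y)%:E = \int[(P \x nu)%E]_z (f (g z))%:E)%E.
  rewrite (@integral_push _ _ _ _ _ _ _ mg (fun y => (f y)%:E))//.
  by apply: (@bounded_integrable _ _ _ _ _ M) => //; exact: measurableT_comp mf mg.
(* The limit law is lifted to pairs $(s,x)$, as the law of a map constant in [x], so that all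
   integrals are against one measure. *)
rewrite (eq_measure_integral (push (P \x nu)%E mG)); last first.
  move=> B mB _; set A := GammaS w @^-1` B : set (Omega L).
  have mA : measurable A.
    by rewrite -[A]setTI; exact: (GammaS_measurable cX cL cw measurableT mB).
  transitivity ((P \x nu)%E (A `*` setT)); first exact/esym/product_measure_XT.
  by congr ((P \x nu)%E _); apply/seteqP; split => -[s x] //= [].
rewrite iE (_ : (fun n => _) =
  (fun n => \int[(P \x nu)%E]_z (f (comp_n w z.1 n z.2))%:E)%E); last first.
  by apply/funext => n; exact: iE.
have [] // := @dominated_convergence _ _ R (P \x nu)%E setT measurableT
  (fun n z => (f (comp_n w z.1 n z.2))%:E) (fun z => (f (GammaS w z.1))%:E) (EFin \o cst M).
- by move=> n; exact: (measurableT_comp mfE (comp_n_measurable cX cL cw n)).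
- exact: (measurableT_comp mfE mG).
(* Convergence can fail only for [s] outside [S_hyp w], and these pairs form a null set. *)
- exists ((~` S_hyp w) `*` setT); split.
  + by apply: measurableX => //; exact: measurableC.
  + rewrite [LHS](product_measure_XT P nu (measurableC mS)).
    by rewrite [LHS](probability_setC P mS) PS subee.
  + move=> [s x] /= ns; split=> // Ss; apply: ns => _; rewrite GammaS_E//.
    apply: cvg_EFin; first by near=> n.
    apply: (cvg_comp _ _ (comp_n_cvg_Gamma cX cw x Ss)); exact: cf.
- by apply: (@bounded_integrable _ _ _ (P \x nu)%E (cst M) `|M|).
- by apply: aeW => z n _; rewrite lee_fin.
Unshelve. all: by end_near. Qed.

Lemma limit_law_fixed B : measurable B -> transfer w p limit_law B = limit_law B.
Proof.
move=> mB.
pose G (z : borel_of L * Omega L) : Omega L := scons z.1 z.2.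
have mG := scons_measurable (L:=L).
have mGamma := GammaS_measurable cX cL cw.
have mwG : measurable_fun [set: borel_of L * Omega L]
    (fun z : borel_of L * Omega L => w (z.1, GammaS w z.2) : borel_of X).
  apply: (measurableT_comp (w_measurable cX cL cw)); apply: measurable_fun_pair.
    exact: measurable_fst.
  exact: (measurableT_comp mGamma measurable_snd).
have mpre d (T : measurableType d) d' (T' : measurableType d') (f : T -> T') C :
    measurable_fun setT f -> measurable C -> measurable (f @^-1` C).
  by move=> mf mC; have := mf measurableT C mC; rewrite setTI.
(* [GammaS] gets evaluated at [scons l s] and at [s]; on this almost sure event it is [Gamma] at
   both, and the cocycle identity applies. *)
pose S2 := G @^-1` S_hyp w `&` setT `*` S_hyp w.
have pS2 : (p \x P)%E S2 = 1%E.
  rewrite /S2 [LHS]probability_setIr1//.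
  - exact: etrans (push_scons prodP mS) PS.
  - exact: mpre.
  - exact: measurableX.
  - rewrite [LHS](product_measure1E p P measurableT mS) [X in (_ * X)%E]PS mule1.
    exact: probability_setT.
have mS2 : measurable S2.
  by apply: measurableI; [exact: mpre|exact: measurableX].
transitivity ((p \x P)%E ((fun z : borel_of L * Omega L => w (z.1, GammaS w z.2)) @^-1` B)).
  apply: eq_integral => l _ /=; rewrite pushE; congr (P _).
  by apply/seteqP; split => s; rewrite /xsection /= inE.
have mGB := mpre _ _ _ _ _ _ mGamma mB.
transitivity ((p \x P)%E (G @^-1` (GammaS w @^-1` B))); last first.
  exact: (push_scons prodP mGB).
have mwGB := mpre _ _ _ _ _ _ mwG mB; have mGGB := mpre _ _ _ _ _ _ mG mGB.
rewrite -[LHS](probability_setIr1 (S:=S2))// -[RHS](probability_setIr1 (S:=S2))//.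
congr ((p \x P)%E _); apply/seteqP.
by split => -[l s] [/= Bls [/= Sls [_ Ss]]]; split=> //; move: Bls;
  rewrite /preimage /= !GammaS_E// Gamma_scons.
Qed.

Lemma limit_law_unique (nu : probability (borel_of X) R) :
  (forall B, measurable B -> transfer w p nu B = nu B) ->
  forall B, measurable B -> nu B = limit_law B.
Proof.
move=> nufix.
have orb n B : measurable B -> orbit_law nu n B = nu B.
  elim: n B => [|n IHn] B mB; first exact: orbit_law0.
  by rewrite orbit_lawS// (eq_transfer IHn mB) nufix.
apply: probability_eq_continuous; first exact: compact_second_countable.
move=> f cf; have := orbit_law_cvg nu cf.
rewrite (_ : (fun n => _) = (fun=> \int[nu]_(x in [set: borel_of X]) (f x)%:E)%E).
  by move=> h; apply/esym/(cvg_unique _ h) => //; exact: cvg_cst.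
by apply/funext => n; apply: eq_measure_integral => C mC _; exact: orb.
Qed.

Lemma limit_law_supp :
  (forall U : set L, open U -> U !=set0 -> (0 < p U)%E) ->
  supp limit_law = closure (Gamma_img w).
Proof.
move=> pfull.
have mGU (U : set X) : open U -> measurable (GammaS w @^-1` U : set (Omega L)).
  move=> oU; have := GammaS_measurable cX cL cw measurableT (open_measurable_borel oU).
  by rewrite setTI.
rewrite (Gamma_imgE cX cw); apply/seteqP; split => [x xsupp N|x xcl U oU Ux].
  rewrite nbhsE => -[U [oU Ux] UN].
  (* Positive mass survives the intersection with [S_hyp w], which yields a value of [Gamma] on
     [S_hyp w] inside [U]. *)
  have : P ((GammaS w @^-1` U) `&` S_hyp w) != 0%E.
    by rewrite [X in X != _](probability_setIr1 (mGU _ oU) mS PS) gt_eqF//; exact: xsupp.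
  have [->|/set0P[s [GU Ss]] _] :=
      eqVneq ((GammaS w @^-1` U) `&` S_hyp w : set (Omega L)) set0.
    by rewrite [P _]measure0 eqxx.
  exists (Gamma w s); split; first by exists s.
  by apply: UN; move: GU; rewrite /= GammaS_E.
have [y [[s Ss <-] Uy]] := xcl U (open_nbhs_nbhs (conj oU Ux)).
have /(nbhs_ballP (Gamma w s))[e /= e0 eU] : nbhs (Gamma w s) U by exact: open_nbhs_nbhs.
have e20 : 0 < e / 2 by rewrite divr_gt0.
(* Half of [e] bounds distances inside the [n]-th image along [s]; the other half pays for changing
   [s] within the cylinder. *)
have [n nP] := S_hyp_lt cX Ss e20.
have [V Vs VP] := comp_n_near cX cw s n e20.
have mV i : measurable (V i : set (borel_of L)).
  by apply: open_measurable_borel; case: (Vs i).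
have mbox : measurable (box n V) by apply: boxes_measurable; exists n, V.
(* The mass of the cylinder is a finite product of factors [p (V i)], each positive by full support
   of [p]. *)
apply: (@lt_le_trans _ _ (P (box n V `&` S_hyp w))).
  rewrite [X in (_ < X)%E](probability_setIr1 mbox mS PS) [X in (_ < X)%E](prodP n mV).
  apply: (big_ind (fun t => 0 < t)%E) => //; first exact: mule_gt0.
  by move=> i _; apply: pfull; [case: (Vs i)|exists (s i); case: (Vs i)].
apply: le_measure; rewrite ?inE; [exact: measurableI|exact: mGU|].
move=> s' [Vs' Ss'] /=; rewrite GammaS_E//; apply: eU; rewrite ballEmdist /=.
(* [Gamma w s'] is the image of some [x'] along [s']; the image of the same [x'] along [s] is the
   intermediate point. *)
have [x' _ <-] := Gamma_mem cX cw s' n.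
apply: (le_lt_trans (metric_triangle _ (comp_n w s n x') _)).
rewrite (splitr e) ltrD//; last exact: VP.
apply: (nP n) => //; exact: Gamma_mem.
Qed.

End dynamics.

Theorem theorem1 (R : realType) (X L : pointedMetricType R)
  (w : L * X -> X) (p : probability (borel_of L) R)
  (P : probability (Omega L) R) :
  compact [set: X] -> compact [set: L] -> continuous w ->
  is_product_measure p P ->
  P (S_hyp w) = 1%E ->
  exists mu : probability (borel_of X) R,
    (forall B : set (borel_of X), measurable B -> transfer w p mu B = mu B) /\
    (forall mu' : probability (borel_of X) R,
       (forall B : set (borel_of X), measurable B -> transfer w p mu' B = mu' B) ->
       forall B : set (borel_of X), measurable B -> mu' B = mu B) /\
    (forall nu : probability (borel_of X) R,
       exists nus : nat -> probability (borel_of X) R,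
         (forall B : set (borel_of X), measurable B -> nus 0%N B = nu B) /\
         (forall (n : nat) (B : set (borel_of X)), measurable B ->
            nus n.+1 B = transfer w p (nus n) B) /\
         weak_star_cvg nus mu) /\
    ((forall U : set L, open U -> U !=set0 -> (0 < p U)%E) ->
       supp mu = closure (Gamma_img w)).
Proof.
move=> cX cL cw prodP PS; exists (limit_law P cX cL cw); split.
  by move=> B; exact: limit_law_fixed.
split; first by move=> nu nufix; exact: (limit_law_unique cX cL cw prodP PS nufix).
split; last exact: limit_law_supp.
move=> nu; exists (orbit_law P cX cL cw nu); split; first exact: orbit_law0.
split; first by move=> n B; exact: orbit_lawS.
exact: orbit_law_cvg.
Qed.
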